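(* Let $\mathbf A$ be a finite idempotent simple algebra with $|A|>2$ such that there exists a subuniverse of $\mathbf A^2$ which is proper, irredundant and subdirect. Then there exists a $\mu_{\mathbf A}$-class $B$ such that for every $b\in B$ and every $a\in A\setminus B$, the pair $(a,b)$ is a semilattice edge witnessed by the equality congruence of $\mathrm{Sg}_{\mathbf A}(a,b)$.
   Context: A relation $R\subseteq A^2$ is subdirect if both projections are $A$, proper if $R\neq A^2$, irredundant if it is not the graph of a bijection. $\mathrm{Sg}_{\mathbf A}(a,b)$ is the subuniverse generated by $a,b$. $\mu_{\mathbf A}$ is the smallest equivalence on $A$ containing all pairs $(a,b)$ with $\mathrm{Sg}_{\mathbf A}(a,b)\neq A$. A pair $(a,b)$ is a semilattice edge witnessed by a proper congruence $\theta$ of $\mathrm{Sg}_{\mathbf A}(a,b)$ if there is a binary term operation $f$ of $\mathbf A$ which acts on the two classes $\{a/\theta,b/\theta\}$ as a join-semilattice operation with top element $b/\theta$. *)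

(* Defs.v *)
From mathcomp Require Import all_boot.
From mathcomp Require Import boolp classical_sets.

Set Implicit Arguments.
Unset Strict Implicit.
Unset Printing Implicit Defensive.

Local Open Scope classical_set_scope.

Record signature := Signature { symbol : Type; arity : symbol -> nat }.

(* An algebra of signature S is a carrier T together with F : operations S T. *)
Definition operations (S : signature) (T : Type) :=
  forall s : symbol S, ('I_(arity s) -> T) -> T.

Definition prod_operations (S : signature) (T U : Type)
    (F : operations S T) (G : operations S U) : operations S (T * U) :=
  fun s x => (F s (fst \o x), G s (snd \o x)).

Definition idempotent_algebra (S : signature) (T : Type)
    (F : operations S T) : Prop :=
  forall (s : symbol S) (x : T), F s (fun _ => x) = x.

Inductive term (S : signature) (n : nat) : Type :=
| Var of 'I_n
| App (s : symbol S) of ('I_(arity s) -> term S n).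

Fixpoint eval_term (S : signature) (n : nat) (T : Type) (F : operations S T)
    (v : 'I_n -> T) (t : term S n) : T :=
  match t with
  | Var i => v i
  | App s args => F s (fun j => eval_term F v (args j))
  end.

Definition binary_term_operation (S : signature) (T : Type)
    (F : operations S T) (f : T -> T -> T) : Prop :=
  exists t : term S 2,
    forall x y : T,
      f x y = eval_term F (fun i : 'I_2 => if i == ord0 then x else y) t.

Definition subuniverse (S : signature) (T : Type) (F : operations S T)
    (B : set T) : Prop :=
  forall (s : symbol S) (x : 'I_(arity s) -> T),
    (forall i, B (x i)) -> B (F s x).

Definition Sg (S : signature) (T : Type) (F : operations S T) (X : set T) :
  set T := smallest (subuniverse F) X.

Definition equivalence_on (T : Type) (B : set T) (th : set (T * T)) : Prop :=
  [/\ th `<=` B `*` B,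
      forall x, B x -> th (x, x),
      forall x y, th (x, y) -> th (y, x) &
      forall x y z, th (x, y) -> th (y, z) -> th (x, z)].

Definition eq_class (T : Type) (th : set (T * T)) (x : T) : set T :=
  [set y | th (x, y)].

Definition equality_on (T : Type) (B : set T) : set (T * T) :=
  [set p | B p.1 /\ p.1 = p.2].

(* Congruences of the subalgebra with universe B, as relations on T
   contained in B `*` B. *)
Definition congruence_on (S : signature) (T : Type) (F : operations S T)
    (B : set T) (th : set (T * T)) : Prop :=
  equivalence_on B th /\ subuniverse (prod_operations F F) th.

Definition simple_algebra (S : signature) (T : Type)
    (F : operations S T) : Prop :=
  (exists x y : T, x <> y) /\
  forall th : set (T * T), congruence_on F setT th ->
    th = equality_on setT \/ th = setT.

Definition proper_rel (T : Type) (R : set (T * T)) : Prop := R <> setT.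

Definition subdirect (T : Type) (R : set (T * T)) : Prop :=
  fst @` R = setT /\ snd @` R = setT.

Definition irredundant (T : Type) (R : set (T * T)) : Prop :=
  ~ exists g : T -> T, bijective g /\ R = [set p | p.2 = g p.1].

Definition mu (S : signature) (T : Type) (F : operations S T) : set (T * T) :=
  smallest (equivalence_on setT) [set p | Sg F [set p.1; p.2] <> setT].

(* For a congruence th compatible with f and th-classes C and D, this is the
   class (C, D) |-> (f x y)/th, for any x in C and y in D. *)
Definition quotient_op (T : Type) (th : set (T * T)) (f : T -> T -> T)
    (C D : set T) : set T :=
  [set z | exists x y, [/\ C x, D y & th (f x y, z)]].

Definition semilattice_op_on (U : Type) (X : set U) (g : U -> U -> U) : Prop :=
  [/\ forall x y, X x -> X y -> X (g x y),
      forall x, X x -> g x x = x,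
      forall x y, X x -> X y -> g x y = g y x &
      forall x y z, X x -> X y -> X z -> g x (g y z) = g (g x y) z].

(* In the join order, x <= y means g x y = y. *)
Definition join_top (U : Type) (X : set U) (g : U -> U -> U) (t : U) : Prop :=
  X t /\ forall x, X x -> g x t = t.

Definition semilattice_edge (S : signature) (T : Type) (F : operations S T)
    (a b : T) (th : set (T * T)) : Prop :=
  let B := Sg F [set a; b] in
  let X := [set eq_class th a; eq_class th b] in
  [/\ congruence_on F B th,
      th <> B `*` B &
      exists f : T -> T -> T,
        [/\ binary_term_operation F f,
            semilattice_op_on X (quotient_op th f) &
            join_top X (quotient_op th f) (eq_class th b)]].

(* Main.v *)
Require Import Defs.
From mathcomp Require Import all_boot.
From mathcomp Require Import boolp classical_sets.

Set Implicit Arguments.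
Unset Strict Implicit.

(** The case [mu F = setT] is trivial; assume otherwise.  If [R] is proper,
    irredundant and subdirect, then [R o R^-1 = A^2], so two elements not
    related by [mu] have a common neighbour [d]; as they generate the algebra,
    [d] is related to everything.  Hence [R] has left and right centers, each
    contained in one [mu]-class, and a pair [(x, y)] of [R] with [x] outside the
    class of the left center has [y] in the right center.  By simplicity and
    [#|A| > 2], all centers of all such relations lie in one and the same class
    [B].  For [b] in [B] and [a] outside [B], let [Q] be generated by [(a, b)]
    and [(b, a)].  [Q] is not the graph of an automorphism, because composing [R]
    with it would move the right center out of [B]; so [Q] is full or has
    centers in [B], and then [b] is in its right center because [(a, b)] is in
    [Q].  Either way [Q] contains [(b, b)], which is the required term
    operation. *)

Local Open Scope classical_set_scope.

(** * Subuniverses of the square, centers and generating pairs *)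

Section Relations.
Variables (S : signature) (A : Type) (F : operations S A).
Implicit Types (R Q : set (A * A)) (X : set A).

Let sub2 := subuniverse (prod_operations F F).

Definition rel_comp R Q : set (A * A) :=
  [set p | exists y, R (p.1, y) /\ Q (y, p.2)].

Definition rel_inv R : set (A * A) := [set p | R (p.2, p.1)].

Definition left_center R : set A := [set x | forall y, R (x, y)].

Definition right_center R : set A := [set y | forall x, R (x, y)].

Lemma sub_Sg (T : Type) (G : operations S T) (X : set T) : X `<=` Sg G X.
Proof. exact: sub_gen_smallest. Qed.

Lemma Sg_min (T : Type) (G : operations S T) (X B : set T) :
  subuniverse G B -> X `<=` B -> Sg G X `<=` B.
Proof. by move=> hB hX; apply: smallest_sub. Qed.

Lemma subuniverse_Sg (T : Type) (G : operations S T) (X : set T) :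
  subuniverse G (Sg G X).
Proof.
move=> s x hx B [hB hXB]; apply: (hB) => i.
exact: (hx i B (conj hB hXB)).
Qed.

Lemma subuniverse_setI (T : Type) (G : operations S T) (X Y : set T) :
  subuniverse G X -> subuniverse G Y -> subuniverse G (X `&` Y).
Proof.
by move=> hX hY s x hx; split; [apply: hX|apply: hY] => i; case: (hx i).
Qed.

Lemma sub2P R : sub2 R <->
  forall (s : symbol S) (x y : 'I_(arity s) -> A),
    (forall i, R (x i, y i)) -> R (@F s x, @F s y).
Proof.
split=> [hR s x y hxy | hR s x hx].
  exact: (hR s (fun i => (x i, y i)) hxy).
by apply: hR => i /=; rewrite -surjective_pairing.
Qed.

Lemma sub2_comp R Q : sub2 R -> sub2 Q -> sub2 (rel_comp R Q).
Proof.
move=> /sub2P hR /sub2P hQ; apply/sub2P => s x z /choice[y hy].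
by exists (@F s y); split; [apply: hR|apply: hQ] => i; case: (hy i).
Qed.

Lemma sub2_inv R : sub2 R -> sub2 (rel_inv R).
Proof. by move=> /sub2P hR; apply/sub2P => s x y hxy; apply: hR. Qed.

Lemma subuniverse_fst R : sub2 R -> subuniverse F (fst @` R).
Proof.
move=> /sub2P hR s x hx.
have /choice[y hy] : forall i, exists y, R (x i, y).
  by move=> i; case: (hx i) => -[u v] huv /= <-; exists v.
by exists (@F s x, @F s y) => //; apply: hR.
Qed.

Lemma subuniverse_snd R : sub2 R -> subuniverse F (snd @` R).
Proof.
move=> /sub2P hR s x hx.
have /choice[y hy] : forall i, exists y, R (y, x i).
  by move=> i; case: (hx i) => -[u v] huv /= <-; exists u.
by exists (@F s y, @F s x) => //; apply: hR.
Qed.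

Hypothesis hidem : idempotent_algebra F.

Lemma subuniverse_row R x : sub2 R -> subuniverse F [set y | R (x, y)].
Proof.
by move=> /sub2P hR s y hy /=; rewrite -(@hidem s x); apply: hR.
Qed.

Lemma subuniverse_col R y : sub2 R -> subuniverse F [set x | R (x, y)].
Proof. by move=> /sub2_inv/subuniverse_row; apply. Qed.

Lemma subuniverse_left_center R : sub2 R -> subuniverse F (left_center R).
Proof.
by move=> hR s x hx y; apply: (@subuniverse_col R y hR) => i; apply: hx.
Qed.

Lemma subuniverse_right_center R : sub2 R -> subuniverse F (right_center R).
Proof. by move=> /sub2_inv/subuniverse_left_center. Qed.

Lemma equivalence_mu : equivalence_on setT (mu F).
Proof.
split=> //.
- by move=> x _ th [[_ h _ _] _]; apply: h.
- by move=> x y h th hth; have := h _ hth; case: hth => -[_ _ hs _] _; apply: hs.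
- move=> x y z hxy hyz th hth; have := hyz _ hth; have := hxy _ hth.
  by case: hth => -[_ _ _ ht] _; apply: ht.
Qed.

Lemma mu_refl x : mu F (x, x).
Proof. by case: equivalence_mu => _ h _ _; apply: h. Qed.

Lemma mu_sym x y : mu F (x, y) -> mu F (y, x).
Proof. by case: equivalence_mu => _ _ h _; apply: h. Qed.

Lemma mu_trans x y z : mu F (x, y) -> mu F (y, z) -> mu F (x, z).
Proof. by case: equivalence_mu => _ _ _; apply. Qed.

(** [mu F] contains every pair that fails to generate the algebra. Below, [X] is a row, a column, a
    center or a projection of a relation. *)
Lemma generate_of_not_mu x y X :
  ~ mu F (x, y) -> subuniverse F X -> X x -> X y -> forall z, X z.
Proof.
move=> hxy hX Xx Xy z.
have hS : Sg F [set x; y] = setT.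
  by apply: contrapT => h; apply: hxy; apply: sub_gen_smallest.
have : Sg F [set x; y] z by rewrite hS.
by apply: Sg_min => // t [->|->].
Qed.

(** An automorphism maps non-generating pairs to non-generating pairs, so the preimage of [mu F]
    under it is an equivalence containing all of them. *)
Lemma mu_bijective (g : A -> A) :
  bijective g -> sub2 [set p | p.2 = g p.1] ->
  forall x y, mu F (x, y) -> mu F (g x, g y).
Proof.
move=> [h gK hK] /sub2P hg x y.
apply: (smallest_sub (X := [set p | mu F (g p.1, g p.2)])).
  split=> //.
  - by move=> u _; apply: mu_refl.
  - by move=> u v; apply: mu_sym.
  - by move=> u v w; apply: mu_trans.
move=> [u v] /= huv; apply: sub_gen_smallest => /= hguv.
apply: huv; apply/seteqP; split=> // z _.
(* This set is the image under [g] of the subuniverse generated by [u] and [v]. It is a subuniverse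
   containing [g u] and [g v], hence everything. *)
suff : [set t | Sg F [set u; v] (h t)] (g z) by rewrite /= gK.
have : Sg F [set g u; g v] (g z) by rewrite hguv.
apply: Sg_min => [s t ht /=|t [->|->] /=]; last 2 first.
- by rewrite gK; apply: sub_Sg; left.
- by rewrite gK; apply: sub_Sg; right.
have -> : h (@F s t) = @F s (h \o t).
  apply: (can_inj gK); rewrite hK.
  by apply: (hg s (h \o t) t) => i /=; rewrite hK.
exact: subuniverse_Sg.
Qed.

End Relations.

(** * Relations on a finite simple algebra *)

Section Simple.
Variables (S : signature) (A : finType) (F : operations S A).
Hypothesis hidem : idempotent_algebra F.
Hypothesis hsimple : simple_algebra F.
Implicit Types (R Q : set (A * A)).

Let sub2 := subuniverse (prod_operations F F).

Lemma simple_equivalence R :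
  sub2 R -> (forall x, R (x, x)) -> (forall x y, R (x, y) -> R (y, x)) ->
  (forall x y z, R (x, y) -> R (y, z) -> R (x, z)) ->
  (forall x y, R (x, y) -> x = y) \/ R = setT.
Proof.
move=> hR hr hs ht; case: hsimple => _ /(_ R) [|->|]; [|left|by right].
  by split=> //; split=> // x _.
by move=> x y [].
Qed.

(* A maximal such relation [R] satisfies [R o R = A^2]. *)
Lemma mu_full_of_reflexive_symmetric R :
  sub2 R -> (forall x, R (x, x)) -> (forall x y, R (x, y) -> R (y, x)) ->
  R <> setT -> (exists x y, R (x, y) /\ x <> y) -> mu F = setT.
Proof.
(* Induction on the number of pairs outside [R]. *)
move: {2}#|[set p | ~~ `[< R p >]]%SET|.+1 (ltnSn #|[set p | ~~ `[< R p >]]%SET|) => n.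
elim: n R => // n IH R hn hR hr hs hT [x0 [y0 [hxy0 hne0]]].
pose R2 := rel_comp R R.
have RR2 p : R p -> R2 p by case: p => x y h; exists y.
have hR2 : sub2 R2 by apply: sub2_comp.
have hr2 x : R2 (x, x) by apply: RR2.
have hs2 x y : R2 (x, y) -> R2 (y, x).
  by case=> z [/= h1 h2]; exists z; split; apply: hs.
have [hR2T|hR2T] := pselect (R2 = setT).
  apply: contrapT => hmu.
  have [x [y hxy]] : exists x y, ~ mu F (x, y).
    apply: contrapT => h; apply: hmu; apply/seteqP; split=> // -[x y] _.
    by apply: contrapT => h'; apply: h; exists x, y.
  (* The row of [d] contains the generating pair [x], [y]. Any [z] not [mu]-related to [d] is then
     in the left center as well, and [d], [z] generate [A]. *)
  have [d [/= hxd hdy]] : R2 (x, y) by rewrite hR2T.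
  have dL : left_center R d.
    exact: (generate_of_not_mu hxy (subuniverse_row hidem hR) (hs _ _ hxd)).
  have [z hz] : exists z, ~ mu F (d, z).
    apply: contrapT => h; apply: hxy; apply: (mu_trans (y := d)).
      by apply: mu_sym; apply: contrapT => ?; apply: h; exists x.
    by apply: contrapT => ?; apply: h; exists y.
  have zL : left_center R z.
    apply: (generate_of_not_mu hz (subuniverse_row hidem hR)); last exact: hr.
    exact: hs.
  apply: hT; apply/seteqP; split=> // -[u v] _.
  exact: (generate_of_not_mu hz (subuniverse_left_center hidem hR) dL zL).
(* If [R2] adds no pair, [R] is transitive, hence a congruence excluded by simplicity; otherwise the
   induction hypothesis applies to [R2]. *)
have [[p [hp1 hp2]]|hno] := pselect (exists p, R2 p /\ ~ R p); last first.
  have [|h|h] := @simple_equivalence R hR hr hs.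
  - move=> x y z h1 h2; apply: contrapT => h3.
    by apply: hno; exists (x, z); split=> //; exists y.
  - by case: hne0; apply: h.
  - by [].
apply: (IH R2) => //; last by exists x0, y0; split=> //; apply: RR2.
rewrite ltnS in hn; apply: leq_trans hn; apply: proper_card.
apply/properP; split.
  by apply/fintype.subsetP => q; rewrite !inE; apply: contra => /asboolP/RR2 h; apply/asboolP.
by exists p; rewrite !inE; [apply/asboolP|rewrite negbK; apply/asboolP].
Qed.

Definition nontrivial_rel R :=
  [/\ sub2 R, proper_rel R, irredundant R & subdirect R].

Lemma subdirectP R : subdirect R <->
  (forall x, exists y, R (x, y)) /\ (forall y, exists x, R (x, y)).
Proof.
split=> [[h1 h2]|[h1 h2]]; split.
- move=> x; have : (fst @` R) x by rewrite h1.
  by case=> -[u v] huv /= <-; exists v.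
- move=> y; have : (snd @` R) y by rewrite h2.
  by case=> -[u v] huv /= <-; exists u.
- by apply/seteqP; split=> // x _; case: (h1 x) => y hy; exists (x, y).
- by apply/seteqP; split=> // y _; case: (h2 y) => x hx; exists (x, y).
Qed.

Lemma graph_inv R (g : A -> A) : bijective g ->
  rel_inv R = [set p | p.2 = g p.1] ->
  exists h, bijective h /\ R = [set p | p.2 = h p.1].
Proof.
move=> [h gK hK] hR; exists h; split; first by exists g.
have e x y : R (x, y) = (x = g y).
  by have := congr1 (fun Q => Q (y, x)) hR.
apply/seteqP; split=> -[x y] /=; rewrite e => ->; first by rewrite gK.
by rewrite hK.
Qed.

(** Provides the left-right duality: facts about right centers transfer to left centers and back. *)
Lemma nontrivial_rel_inv R : nontrivial_rel R -> nontrivial_rel (rel_inv R).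
Proof.
case=> hR hp hi /subdirectP[h1 h2]; split.
- exact: sub2_inv.
- move=> h; apply: hp; apply/seteqP; split=> // -[x y] _.
  by have : rel_inv R (y, x) by rewrite h.
- by case=> g [hg hgR]; apply: hi; apply: graph_inv hg hgR.
- by apply/subdirectP.
Qed.

(** * Centers when [mu F] is not full *)

Hypothesis hmu : mu F <> setT.

Lemma not_mu_exists : exists x y, ~ mu F (x, y).
Proof.
apply: contrapT => h; apply: hmu; apply/seteqP; split=> // -[x y] _.
by apply: contrapT => h'; apply: h; exists x, y.
Qed.

(** If [R o R^-1], which is reflexive and symmetric, is not full, it lies in the equality because
    [mu F] is not full. Then distinct elements share no neighbour, and by finiteness [R] is the
    graph of a bijection. *)
Lemma common_neighbour R : nontrivial_rel R ->
  forall x x', exists y, R (x, y) /\ R (x', y).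
Proof.
case=> hR hp hi /subdirectP[h1 h2] x x'.
pose Q := rel_comp R (rel_inv R).
have [hQ|hQ] := pselect (Q = setT).
  have [y [/= hy hy']] : Q (x, x') by rewrite hQ.
  by exists y.
have [hne|hinj] := pselect (exists u v, Q (u, v) /\ u <> v).
  exfalso; apply: hmu.
  apply: (@mu_full_of_reflexive_symmetric Q) => //.
  - by apply: sub2_comp => //; apply: sub2_inv.
  - by move=> u; case: (h1 u) => v huv; exists v.
  - by move=> u v [w [hu hv]]; exists w.
have uniq u v w : R (u, w) -> R (v, w) -> u = v.
  by move=> hu hv; apply: contrapT => h; apply: hinj; exists u, v; split=> //; exists w.
case: (choice h2) => g hg; case: hi.
have [f fR] := choice h1.
have gK : cancel f g by move=> u; apply: (uniq _ _ (f u)).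
have fb : bijective f.
  by exists g => //; apply/bij_can_sym => //; apply: injF_bij; exact: can_inj gK.
exists f; split=> //; apply/seteqP; split=> -[u v] /=; last by move=> ->.
case: fb => f' f'K fK huv; rewrite -(fK v); congr f.
by apply/esym; apply: (uniq _ _ v) => //; rewrite -{2}(fK v).
Qed.

Lemma right_center_nonempty R : nontrivial_rel R -> exists c, right_center R c.
Proof.
move=> hR; have [x [y hxy]] := not_mu_exists.
have [c [hx hy]] := common_neighbour hR x y; exists c.
by case: hR => hR _ _ _; apply: (generate_of_not_mu hxy (subuniverse_col hidem hR)).
Qed.

Lemma left_center_nonempty R : nontrivial_rel R -> exists l, left_center R l.
Proof. by move=> /nontrivial_rel_inv/right_center_nonempty. Qed.

(** Otherwise [l] and [l'] would generate [A] inside the left center, making [R] full. *)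
Lemma left_center_mu R l l' : nontrivial_rel R ->
  left_center R l -> left_center R l' -> mu F (l, l').
Proof.
move=> [hR hp _ _] hl hl'; apply: contrapT => h; apply: hp.
apply/seteqP; split=> // -[x y] _.
exact: (generate_of_not_mu h (subuniverse_left_center hidem hR) hl hl').
Qed.

Lemma right_center_mu R c c' : nontrivial_rel R ->
  right_center R c -> right_center R c' -> mu F (c, c').
Proof. by move=> /nontrivial_rel_inv; apply: left_center_mu. Qed.

(** The column of [y] contains both [l] and [x], which generate [A]. *)
Lemma right_center_of_not_mu R l x y : nontrivial_rel R ->
  left_center R l -> R (x, y) -> ~ mu F (l, x) -> right_center R y.
Proof.
move=> [hR _ _ _] hl hxy h.
exact: (generate_of_not_mu h (subuniverse_col hidem hR) (hl y) hxy).
Qed.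

Lemma left_center_of_not_mu R c x y : nontrivial_rel R ->
  right_center R c -> R (x, y) -> ~ mu F (c, y) -> left_center R x.
Proof. by move=> /nontrivial_rel_inv; apply: right_center_of_not_mu. Qed.

(** * One [mu]-class for all centers *)

Hypothesis hcard : 2 < #|A|.

(* Otherwise [D = R `&` R'] equals [L * C' `|` L' * C], where [L, C] and
   [L', C'] are the left and right centers of [R] and [R'].  Then [L] and [L']
   partition [A] and [D o D^-1] is a congruence with these two classes. *)
Lemma centers_share_mu_class R R' l c l' c' :
  nontrivial_rel R -> nontrivial_rel R' ->
  left_center R l -> right_center R c ->
  left_center R' l' -> right_center R' c' ->
  mu F (l, l') \/ mu F (c, c').
Proof.
move=> gR gR' hl hc hl' hc'.
apply: contrapT => /not_orP[nl nc].
pose D := R `&` R'.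
have hD : sub2 D.
  by case: gR gR' => hR _ _ _ [hR' _ _ _]; apply: subuniverse_setI.
have Ll x : left_center R x -> ~ left_center R' x.
  move=> h h'; apply: nl; apply: mu_trans (left_center_mu gR hl h) _.
  exact: (left_center_mu gR' h' hl').
have Cc y : right_center R y -> ~ right_center R' y.
  move=> h h'; apply: nc; apply: mu_trans (right_center_mu gR hc h) _.
  exact: (right_center_mu gR' h' hc').
have DP x y : D (x, y) -> left_center R x /\ right_center R' y \/
                          left_center R' x /\ right_center R y.
  move=> [h h'].
  (* If [x] is in the class of [l], it is not in that of [l'], so [y] is in the right center of
     [R']. Then [y] is not in the class of [c], so [x] is in the left center of [R]. The other case
     is similar. *)
  have [m|m] := pselect (mu F (l, x)).
    have y' : right_center R' y.
      apply: (right_center_of_not_mu gR' hl' h') => m'.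
      by apply: nl; apply: mu_trans m _; apply: mu_sym.
    left; split=> //; apply: (left_center_of_not_mu gR hc h) => m'.
    by apply: nc; apply: mu_trans m' _; apply: (right_center_mu gR').
  have yC := right_center_of_not_mu gR hl h m.
  right; split=> //; apply: (left_center_of_not_mu gR' hc' h') => m'.
  by apply: nc; apply: mu_sym; apply: mu_trans m' _; apply: (right_center_mu gR).
(* [D] contains [(l, c')] and [(l', c)], and [l], [l'] generate [A]. *)
have cov x : left_center R x \/ left_center R' x.
  have : (fst @` D) x.
    apply: (generate_of_not_mu nl (subuniverse_fst hD)).
      by exists (l, c').
    by exists (l', c).
  by case=> -[u v] /DP h /= <-; case: h => -[h _]; [left|right].
pose E := rel_comp D (rel_inv D).
have EP x y : E (x, y) <-> left_center R x /\ left_center R y \/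
                           left_center R' x /\ left_center R' y.
  split=> [[z [/DP h1 /DP h2]]|[[h1 h2]|[h1 h2]]]; last 2 first.
  - by exists c'; split; split; [exact: h1|exact: hc'|exact: h2|exact: hc'].
  - by exists c; split; split; [exact: hc|exact: h1|exact: hc|exact: h2].
  case: h1 h2 => [[h1 h2]|[h1 h2]] [[h3 h4]|[h3 h4]]; [by left| | |by right].
    by case: (Cc _ h4).
  by case: (Cc _ h2).
have [||||eqE|EN] := @simple_equivalence E; last 1 first.
- have : E (l, l') by rewrite EN.
  by move=> /EP[[_ h]|[h _]]; [case: (Ll _ h)|case: (Ll _ hl)].
- by apply: sub2_comp => //; apply: sub2_inv.
- by move=> x; apply/EP; case: (cov x) => h; [left|right].
- by move=> x y /EP[[]|[]] ? ?; apply/EP; [left|right].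
- move=> x y z /EP[[a b]|[a b]] /EP[[d e]|[d e]]; apply/EP.
  + by left.
  + by case: (Ll _ b).
  + by case: (Ll _ d).
  + by right.
(* Since [E] is the equality, both left centers are singletons. *)
suff : #|A| <= #|[set l; l']%SET|.
  by rewrite cards2 leqNgt (leq_ltn_trans _ hcard) //; case: (_ != _).
rewrite -cardsT; apply: subset_leq_card; apply/fintype.subsetP => x _; rewrite !inE.
by case: (cov x) => h; apply/orP; [left|right]; apply/eqP; apply: eqE; apply/EP; [left|right].
Qed.

(** Inversion swaps the two centers, so comparing [R] with [rel_inv R] gives the same conclusion in
    both alternatives. *)
Lemma left_right_center_mu R l c : nontrivial_rel R ->
  left_center R l -> right_center R c -> mu F (l, c).
Proof.
move=> gR hl hc.
have [//|] := centers_share_mu_class gR (nontrivial_rel_inv gR) hl hc hc hl.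
exact: mu_sym.
Qed.

Lemma irredundant_of_left_center R l : left_center R l -> irredundant R.
Proof.
move=> hl [g [_ hg]]; have [x [y hxy]] := not_mu_exists.
have e z : z = g l by have := hl z; rewrite hg.
by apply: hxy; rewrite (e x) (e y); apply: mu_refl.
Qed.

(** Left centers survive the composition, which yields irredundancy. *)
Lemma nontrivial_rel_comp_graph R Q g : nontrivial_rel R -> sub2 Q ->
  bijective g -> Q = [set p | p.2 = g p.1] -> nontrivial_rel (rel_comp R Q).
Proof.
move=> gR hQ [h gK hK] Qg; have [l hl] := left_center_nonempty gR.
case: gR => hR hp _ /subdirectP[h1 h2].
have RQ x z : rel_comp R Q (x, z) <-> R (x, h z).
  rewrite Qg; split=> [[y [/= hxy ->]]|hxz]; first by rewrite gK.
  by exists (h z); split=> //=; rewrite hK.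
split.
- exact: sub2_comp.
- move=> hT; apply: hp; apply/seteqP; split=> // -[x y] _.
  by rewrite -(gK y); apply/RQ; rewrite hT.
- by apply: (@irredundant_of_left_center _ l) => z; apply/RQ.
- apply/subdirectP; split=> [x|z]; last first.
    by case: (h2 (h z)) => x hx; exists x; apply/RQ.
  by case: (h1 x) => y hy; exists (g y); apply/RQ; rewrite gK.
Qed.

Lemma swap_generates_diagonal R c a b : nontrivial_rel R -> right_center R c ->
  mu F (c, b) -> ~ mu F (c, a) ->
  Sg (prod_operations F F) [set (a, b); (b, a)] (b, b).
Proof.
move=> gR hc cb nca.
have [l hl] := left_center_nonempty gR.
have nab : ~ mu F (a, b).
  by move=> ab; apply: nca; apply: mu_trans cb (mu_sym ab).
set Q := Sg _ _.
have hQ : sub2 Q by apply: subuniverse_Sg.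
have Qab : Q (a, b) by apply: sub_Sg; left.
have Qba : Q (b, a) by apply: sub_Sg; right.
have [->//|pQ] := pselect (Q = setT).
have [[g [bg Qg]]|iQ] := pselect (exists g, bijective g /\ Q = [set p | p.2 = g p.1]).
  (* The composite has [l] in its left and [g c] in its right center, so [c], [l] and [g c] are
     [mu]-related. As [g] preserves [mu F], [g c] is also related to [g b], which is [a]. *)
  have gT := nontrivial_rel_comp_graph gR hQ bg Qg.
  have ga : g b = a by move: Qba; rewrite Qg.
  exfalso; apply: nca; apply: (mu_trans (y := l)).
    by apply: mu_sym; apply: left_right_center_mu hl hc.
  apply: (mu_trans (y := g c)); last first.
    by rewrite -ga; apply: mu_bijective => //; rewrite -Qg.
  apply: (left_right_center_mu gT) => [z|x].
    case: bg => h gK hK; exists (h z); split; first exact: hl.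
    by rewrite Qg /= hK.
  by exists c; split; [apply: hc|rewrite Qg].
have gQ : nontrivial_rel Q.
  split=> //; apply/subdirectP; split=> z.
    have : (fst @` Q) z.
      by apply: (generate_of_not_mu nab (subuniverse_fst hQ)); [exists (a, b)|exists (b, a)].
    by case=> -[u v] huv /= <-; exists v.
  have : (snd @` Q) z.
    by apply: (generate_of_not_mu nab (subuniverse_snd hQ)); [exists (b, a)|exists (a, b)].
  by case=> -[u v] huv /= <-; exists u.
have [l' hl'] := left_center_nonempty gQ.
have [c' hc'] := right_center_nonempty gQ.
(* It remains to see that [l'] is in the class of [c], which holds because the centers of [R] and
   [Q] share one class. *)
apply: (right_center_of_not_mu gQ hl' Qab) => l'a; apply: nca.
apply: mu_trans l'a.
have lc := left_right_center_mu gR hl hc.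
have l'c' := left_right_center_mu gQ hl' hc'.
case: (centers_share_mu_class gR gQ hl hc hl' hc') => h.
  exact: mu_trans (mu_sym lc) h.
exact: mu_trans h (mu_sym l'c').
Qed.

End Simple.

(** * From the pair [(b, b)] to a semilattice operation *)

Section Edge.
Variables (S : signature) (A : Type) (F : operations S A).
Hypothesis hidem : idempotent_algebra F.

Let valuation (x y : A) := fun i : 'I_2 => if i == ord0 then x else y.

(** The pairs of values of a term at [(a, b)] and at [(b, a)] form a subuniverse of the square; the
    two variables give the generators. *)
Lemma binary_term_of_Sg (a b c d : A) :
  Sg (prod_operations F F) [set (a, b); (b, a)] (c, d) ->
  exists t : term S 2,
    eval_term F (valuation a b) t = c /\ eval_term F (valuation b a) t = d.
Proof.
pose B := [set p | exists t : term S 2,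
  eval_term F (valuation a b) t = p.1 /\ eval_term F (valuation b a) t = p.2].
apply: (@Sg_min _ _ _ _ B) => [s x /choice[t ht]|p [->|->]].
- by exists (App t); split=> /=; apply: (congr1 (@F s)); apply: funext => i; case: (ht i).
- by exists (Var _ ord0).
- by exists (Var _ ord_max).
Qed.

Lemma eval_term_idem n (v : 'I_n -> A) (t : term S n) x :
  (forall i, v i = x) -> eval_term F v t = x.
Proof.
move=> hv; elim: t => //= s args IH.
by rewrite -[RHS](@hidem s x); apply: (congr1 (@F s)); apply: funext.
Qed.

Lemma congruence_equality_on (B : set A) :
  subuniverse F B -> congruence_on F B (equality_on B).
Proof.
move=> hB; split; first split.
- by move=> [x y] [/= hx <-].
- by [].
- by move=> x y [/= hx <-].
- by move=> x y z [/= hx <-].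
move=> s x hx; split=> /=; first by apply: hB => i; case: (hx i).
by apply: (congr1 (@F s)); apply: funext => i; case: (hx i).
Qed.

Lemma semilattice_edge_equality (a b : A) : a <> b ->
  Sg (prod_operations F F) [set (a, b); (b, a)] (b, b) ->
  semilattice_edge F a b (equality_on (Sg F [set a; b])).
Proof.
move=> nab /binary_term_of_Sg[t [tab tba]].
rewrite /semilattice_edge; set B := Sg F _.
have Ba : B a by apply: sub_Sg; left.
have Bb : B b by apply: sub_Sg; right.
split; first by apply: congruence_equality_on; apply: subuniverse_Sg.
  by move=> /(congr1 (fun Q => Q (a, b))) /= h; case: nab; have [] : equality_on B (a, b) by rewrite h.
pose f x y := eval_term F (valuation x y) t.
exists f.
have fxx x : f x x = x.
  by apply: eval_term_idem => i; rewrite /valuation; case: ifP.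
have cE x : B x -> eq_class (equality_on B) x = [set x].
  move=> hx; apply/seteqP; split=> y; first by case=> /= _ <-.
  by move=> ->; split.
(* The value must lie in [B] because the equality congruence relates only elements of [B]. *)
have qE x y : B (f x y) ->
    quotient_op (equality_on B) f [set x] [set y] = [set f x y].
  move=> hf; apply/seteqP; split=> z; first by case=> u [v [-> -> []]].
  by move=> ->; exists x, y.
rewrite !cE //; set g := quotient_op _ f.
have gaa : g [set a] [set a] = [set a] by rewrite /g qE fxx.
have gbb : g [set b] [set b] = [set b] by rewrite /g qE fxx.
have gab : g [set a] [set b] = [set b] by rewrite /g qE /f tab.
have gba : g [set b] [set a] = [set b] by rewrite /g qE /f tba.
split; first by exists t.
  split.
  - by move=> x y [->|->] [->|->]; rewrite ?gaa ?gab ?gba ?gbb; [left|right|right|right].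
  - by move=> x [->|->].
  - by move=> x y [->|->] [->|->]; rewrite ?gab ?gba.
  - by move=> x y z [->|->] [->|->] [->|->]; rewrite !(gaa, gab, gba, gbb) ?(gaa, gab, gba, gbb).
by split; [right|move=> x [->|->]].
Qed.

End Edge.

Theorem mainTheorem6 (S : signature) (A : finType) (F : operations S A)
    (hidem : idempotent_algebra F) (hsimple : simple_algebra F)
    (hcard : 2 < #|A|)
    (hR : exists R : set (A * A),
        [/\ subuniverse (prod_operations F F) R,
            proper_rel R, irredundant R & subdirect R]) :
  exists B : set A,
    (exists c : A, B = eq_class (mu F) c) /\
    (forall b : A, B b -> forall a : A, ~ B a ->
       semilattice_edge F a b (equality_on (Sg F [set a; b]))).
Proof.
case: hR => R gR.
have [hmu|hmu] := pselect (mu F = setT).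
  case: hsimple => -[c _] _; exists (eq_class (mu F) c).
  split=> [|b _ a nB]; first by exists c.
  by case: nB; rewrite /eq_class /= hmu.
(* Any element of the right center of [R] determines the class [B]. *)
have [c hc] := right_center_nonempty hidem hsimple hmu gR.
exists (eq_class (mu F) c); split=> [|b cb a nca]; first by exists c.
have ab : a <> b by move=> e; apply: nca; rewrite e.
apply: (semilattice_edge_equality hidem ab).
exact: swap_generates_diagonal gR hc cb nca.
Qed.
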